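(* Let $d,p\ge 1$ be integers. For $r=1,\ldots,p$ let $K_r:\mathbb{R}^d\times\mathbb{R}^d\to\mathbb{R}$ be given by $K_r(x,x')=(x^\top x')^r$, and let $a_r\ge 0$ be real numbers. Define $$K(x,x')=\sum_{r=1}^{p} a_r^2\,K_r(x,x')=\sum_{r=1}^{p} a_r^2\,(x^\top x')^r,\qquad x,x'\in\mathbb{R}^d.$$ Then $K$ is a positive semidefinite kernel on $\mathbb{R}^d$. Moreover, every $f\in\mathcal{H}(K)$ admits a decomposition $f=\sum_{r=1}^{p} f_r$ with $f_r\in\mathcal{H}(K_r)$ for each $r=1,\ldots,p$.
   Context: A kernel $K:\mathbb{R}^d\times\mathbb{R}^d\to\mathbb{R}$ is positive semidefinite if it is symmetric and $\sum_{i,j=1}^n c_i c_j K(x_i,x_j)\ge 0$ for all $n\ge 1$, all $x_1,\ldots,x_n\in\mathbb{R}^d$ and all $c_1,\ldots,c_n\in\mathbb{R}$. For a positive semidefinite kernel $K$, $\mathcal{H}(K)$ denotes the reproducing kernel Hilbert space (of real-valued functions on $\mathbb{R}^d$) induced by $K$; each $K_r$ is itself positive semidefinite, so $\mathcal{H}(K_r)$ is well defined. *)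

(* Defs.v *)
From mathcomp Require Import all_boot all_order all_algebra.
From mathcomp Require Import all_classical all_reals all_analysis.

Set Implicit Arguments.
Unset Strict Implicit.
Unset Printing Implicit Defensive.

Import Order.TTheory GRing.Theory Num.Theory.
Import numFieldNormedType.Exports.

Local Open Scope classical_set_scope.
Local Open Scope ring_scope.

Definition psd_kernel (R : realType) (X : Type) (K : X -> X -> R) : Prop :=
  (forall x y, K x y = K y x) /\
  (forall n, (1 <= n)%N -> forall (x : 'I_n -> X) (c : 'I_n -> R),
     0 <= \sum_(i < n) \sum_(j < n) c i * c j * K (x i) (x j)).

Record is_linear_subspace (R : realType) (X : Type) (H : set (X -> R)) : Prop :=
  { subspace0 : H 0;
    subspaceD : forall f g, H f -> H g -> H (f + g);
    subspaceZ : forall (c : R) f, H f -> H (c \*o f) }.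

(* [ip] is a total function on [X -> R]; only its values on [H] matter.
   Linearity in the second argument follows by symmetry. *)
Record is_inner_product (R : realType) (X : Type) (H : set (X -> R))
    (ip : (X -> R) -> (X -> R) -> R) : Prop :=
  { ip_sym : forall f g, H f -> H g -> ip f g = ip g f;
    ipDl : forall f g h, H f -> H g -> H h -> ip (f + g) h = ip f h + ip g h;
    ipZl : forall (c : R) f g, H f -> H g -> ip (c \*o f) g = c * ip f g;
    ip_ge0 : forall f, H f -> 0 <= ip f f;
    ip_eq0 : forall f, H f -> ip f f = 0 -> f = 0 }.

Definition ip_norm (R : realType) (X : Type) (ip : (X -> R) -> (X -> R) -> R)
  (f : X -> R) : R := Num.sqrt (ip f f).

Definition is_complete (R : realType) (X : Type) (H : set (X -> R))
    (ip : (X -> R) -> (X -> R) -> R) : Prop :=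
  forall u : nat -> X -> R, (forall n, H (u n)) ->
    (forall e : R, 0 < e -> exists N : nat, forall m n : nat,
       (N <= m)%N -> (N <= n)%N -> ip_norm ip (u m - u n) < e) ->
    exists2 f, H f & ip_norm ip (u n - f) @[n --> \oo] --> (0 : R).

(* [(H, ip)] is a Hilbert space of real functions on [X] with reproducing
   kernel [K]. *)
Record is_rkhs (R : realType) (X : Type) (K : X -> X -> R) (H : set (X -> R))
    (ip : (X -> R) -> (X -> R) -> R) : Prop :=
  { rkhs_subspace : is_linear_subspace H;
    rkhs_inner_product : is_inner_product H ip;
    rkhs_complete : is_complete H ip;
    rkhs_kernel : forall x, H (K^~ x);
    rkhs_reproducing : forall f x, H f -> f x = ip f (K^~ x) }.

(* The function space underlying the RKHS of [K].  By the Moore-Aronszajn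
   theorem, a positive semidefinite kernel has exactly one such space [H], with
   [ip] determined on [H], so the existential selects that space. *)
Definition rkhs (R : realType) (X : Type) (K : X -> X -> R) : set (X -> R) :=
  [set f | exists H ip, is_rkhs K H ip /\ H f].

Definition power_kernel (R : realType) (d r : nat) (x x' : 'cV[R]_d) : R :=
  ((x^T *m x') ord0 ord0) ^+ r.

Definition poly_kernel (R : realType) (d p : nat) (a : nat -> R)
  (x x' : 'cV[R]_d) : R :=
  \sum_(1 <= r < p.+1) a r ^+ 2 * power_kernel r x x'.

(* Main.v *)
Require Import Defs.
From mathcomp Require Import all_boot all_order all_algebra.
From mathcomp Require Import all_classical all_reals all_analysis.
Import Order.TTheory GRing.Theory Num.Theory.
Import numFieldNormedType.Exports.
Local Open Scope classical_set_scope.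
Local Open Scope ring_scope.

(* All the kernels here are of finite rank: [K x y] is the dot product of feature
   vectors [phi x], [phi y] in some [R^m].  Choosing finitely many nodes [t i]
   whose features form a basis of the span of [phi], every section of [K] is a
   combination of the sections at the nodes.  Hence, by the reproducing property,
   so is every [f] in the RKHS of [K]: [f = \sum_i c_i K(., t i)].  Expanding [K]
   and collecting the terms of degree [r] gives
   [f_r = \sum_i c_i a_r^2 K_r(., t i)], which lies in the RKHS of [K_r], since
   that space contains the sections of [K_r].  The latter space exists because a
   kernel of finite rank has the RKHS of all [f] of the form
   [y |-> w f . phi y], with inner product [w f . w g], where the coordinates
   [w f] in the span of [phi] are read off the values of [f] at the nodes. *)

(** * Kernels of finite rank and their closure properties *)

Definition finite_rank {R : realType} {X : Type} (K : X -> X -> R) : Prop :=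
  exists (m : nat) (phi : X -> 'rV[R]_m),
    forall x y, K x y = (phi x *m (phi y)^T) 0 0.

Lemma finite_rank0 (R : realType) (X : Type) :
  finite_rank (fun _ _ : X => 0 : R).
Proof. by exists 0, (fun=> 0) => x y; rewrite mul0mx mxE. Qed.

Lemma finite_rank1 (R : realType) (X : Type) :
  finite_rank (fun _ _ : X => 1 : R).
Proof. by exists 1, (fun=> 1%:M) => x y; rewrite mul1mx trmx1 mxE. Qed.

Lemma finite_rankD (R : realType) (X : Type) (K L : X -> X -> R) :
  finite_rank K -> finite_rank L -> finite_rank (fun x y => K x y + L x y).
Proof.
move=> [m [phi Kphi]] [n [psi Lpsi]].
exists (m + n)%N, (fun x => row_mx (phi x) (psi x)) => x y.
by rewrite tr_row_mx mul_row_col mxE Kphi Lpsi.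
Qed.

Lemma dotmx_sym (R : comPzRingType) (m : nat) (u v : 'rV[R]_m) :
  (u *m v^T) 0 0 = (v *m u^T) 0 0.
Proof. by rewrite -[u *m _]trmxK trmx_mul trmxK mxE. Qed.

(** The features of a product are the tensor products [(phi x)^T *m psi x], flattened into rows:
    their dot products factor. *)
Lemma finite_rankM (R : realType) (X : Type) (K L : X -> X -> R) :
  finite_rank K -> finite_rank L -> finite_rank (fun x y => K x y * L x y).
Proof.
move=> [m [phi Kphi]] [n [psi Lpsi]].
exists (m * n)%N, (fun x => mxvec ((phi x)^T *m psi x)) => x y.
rewrite mxvec_dotmul !mulmxA -mulmxA [RHS]mxE big_ord1 Kphi Lpsi.
by rewrite (dotmx_sym _ _ (psi x)).
Qed.

Lemma finite_rank_sqrZ (R : realType) (X : Type) (a : R) (K : X -> X -> R) :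
  finite_rank K -> finite_rank (fun x y => a ^+ 2 * K x y).
Proof.
move=> [m [phi Kphi]]; exists m, (fun x => a *: phi x) => x y.
by rewrite linearZ /= -scalemxAl -scalemxAr scalerA mxE Kphi.
Qed.

Lemma finite_rank_power_kernel (R : realType) (d r : nat) :
  finite_rank (@power_kernel R d r).
Proof.
elim: r => [|r IHr].
  rewrite (_ : power_kernel 0 = fun _ _ => 1); first exact: finite_rank1.
  by apply/funext => x; apply/funext => y; rewrite /power_kernel expr0.
rewrite (_ : power_kernel r.+1 = fun x y =>
  (x^T *m y) ord0 ord0 * power_kernel r x y).
  by apply: finite_rankM => //; exists d, trmx => x y; rewrite trmxK.
by apply/funext => x; apply/funext => y; rewrite /power_kernel exprS.
Qed.

Lemma finite_rank_poly_kernel (R : realType) (d p : nat) (a : nat -> R) :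
  finite_rank (@poly_kernel R d p a).
Proof.
elim: p => [|p IHp].
  rewrite (_ : poly_kernel 0 a = fun _ _ => 0); first exact: finite_rank0.
  by apply/funext => x; apply/funext => y; rewrite /poly_kernel big_geq.
rewrite (_ : poly_kernel p.+1 a = fun x y =>
  poly_kernel p a x y + a p.+1 ^+ 2 * power_kernel p.+1 x y).
  apply: finite_rankD => //; apply: finite_rank_sqrZ.
  exact: finite_rank_power_kernel.
by apply/funext => x; apply/funext => y; rewrite /poly_kernel big_nat_recr.
Qed.

(** * Positive semidefiniteness *)

Lemma dotmx_sqr (R : pzRingType) (m : nat) (v : 'rV[R]_m) :
  (v *m v^T) 0 0 = \sum_i v 0 i ^+ 2.
Proof. by rewrite mxE; apply: eq_bigr => i _; rewrite mxE expr2. Qed.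

Lemma dotmx_ge0 (R : realDomainType) (m : nat) (v : 'rV[R]_m) :
  0 <= (v *m v^T) 0 0.
Proof. by rewrite dotmx_sqr sumr_ge0 // => i _; rewrite sqr_ge0. Qed.

Lemma dotmx_eq0 (R : realDomainType) (m : nat) (v : 'rV[R]_m) :
  (v *m v^T) 0 0 = 0 -> v = 0.
Proof.
rewrite dotmx_sqr => /psumr_eq0P v0; apply/rowP => i; rewrite mxE.
by apply/eqP; rewrite -sqrf_eq0 v0 // => j _; rewrite sqr_ge0.
Qed.

Lemma finite_rank_psd (R : realType) (X : Type) (K : X -> X -> R) :
  finite_rank K -> psd_kernel K.
Proof.
move=> [m [phi Kphi]]; split=> [x y|n _ x c]; first by rewrite !Kphi dotmx_sym.
(* The double sum is the squared norm of this combination of features. *)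
pose v := \sum_i c i *: phi (x i).
suff -> : \sum_i \sum_j c i * c j * K (x i) (x j) = (v *m v^T) 0 0.
  exact: dotmx_ge0.
rewrite /v linear_sum /= mulmx_suml summxE; apply: eq_bigr => i _.
rewrite mulmx_sumr summxE; apply: eq_bigr => j _.
by rewrite linearZ /= -scalemxAl -scalemxAr scalerA mxE Kphi.
Qed.

(** * Nodes whose features form a basis *)

Lemma spanning_points (F : fieldType) (X : Type) (m : nat)
    (phi : X -> 'rV[F]_m) :
  exists (n : nat) (t : 'I_n -> X),
    row_free (\matrix_i phi (t i)) /\
    forall x, (phi x <= \matrix_i phi (t i))%MS.
Proof.
pose P n := `[< exists t : 'I_n -> X, row_free (\matrix_i phi (t i)) >].
have P0 : exists n, P n.
  exists 0; apply/asboolP.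
  exists (fun i : 'I_0 => False_rect X (notF (ltn_ord i))).
  by apply: inj_row_free => v _; apply/rowP => -[].
have Pm n : P n -> (n <= m)%N.
  by move=> /asboolP[t] /eqP <-; exact: rank_leq_col.
(* A largest family of points with independent features spans: a point with its feature outside the
   span could be appended. *)
case: (ex_maxnP P0 Pm) => n /asboolP[t free_t] max_n.
exists n, t; split=> // x; apply: contrapT => phix.
suff /max_n : P (n + 1)%N by rewrite addn1 ltnn.
apply/asboolP; exists (fun i => if fintype.split i is inl j then t j else x).
rewrite (_ : \matrix_i _ = col_mx (\matrix_i phi (t i)) (phi x)); last first.
  apply/row_matrixP => i; rewrite rowK; case: (split_ordP i) => j ->.
    by rewrite rowKu rowK.
  by rewrite rowKd row_id.
apply: inj_row_free => v; rewrite -[v]hsubmxK mul_row_col.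
rewrite [rsubmx v]mx11_scalar mul_scalar_mx.
set c := rsubmx v 0 0 => /eqP eq0.
have c0 : c = 0.
  apply/eqP; apply: contrapT => /negP c0; apply: phix.
  move: eq0; rewrite addrC addr_eq0 => /eqP /(congr1 ( *:%R c^-1)).
  rewrite scalerA mulVf // scale1r -mulNmx scalemxAl => ->.
  exact: submxMl.
move: eq0; rewrite c0 scale0r addr0 mulmx_free_eq0 // => /eqP ->.
by rewrite raddf0 row_mx0.
Qed.

(* [A = G^-1 Phi], where the rows of [Phi] are the features of the nodes and
   [G = Phi Phi^T] is their Gram matrix. *)
Lemma finite_rank_nodes (R : realType) (X : Type) (m : nat)
    (phi : X -> 'rV[R]_m) :
  exists (n : nat) (t : 'I_n -> X) (A : 'M[R]_(n, m)),
    forall y, (\row_i (phi y *m (phi (t i))^T) 0 0) *m A = phi y.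
Proof.
have [n [t [free_t span_t]]] := spanning_points _ _ _ phi.
set Phi := \matrix_i phi (t i) in free_t span_t.
(* If [v G = 0], then [v Phi] has norm zero, so [v Phi = 0], and [v = 0] since the rows of [Phi] are
   independent. *)
have G_unit : Phi *m Phi^T \in unitmx.
  rewrite -row_free_unit; apply: inj_row_free => v vG.
  apply/eqP; rewrite -(mulmx_free_eq0 _ free_t); apply/eqP/dotmx_eq0.
  by rewrite trmx_mul mulmxA -(mulmxA v) vG mul0mx mxE.
exists n, t, (invmx (Phi *m Phi^T) *m Phi) => y.
have -> : \row_i (phi y *m (phi (t i))^T) 0 0 = phi y *m Phi^T.
  by apply/rowP => i; rewrite !mxE; apply: eq_bigr => k _; rewrite !mxE.
(* For [phi y = c Phi] the left side is [c G G^-1 Phi = c Phi]. *)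
have /submxP[c ->] := span_t y.
by rewrite -(mulmxA c) !mulmxA -(mulmxA c) -(mulmxA c) mulmxV // mulmx1.
Qed.

(** * The RKHS of a kernel of finite rank *)

Lemma rkhs_finite_rank_expansion (R : realType) (X : Type) (K : X -> X -> R)
    (f : X -> R) :
  finite_rank K -> rkhs K f ->
  exists (n : nat) (t : 'I_n -> X) (c : 'I_n -> R),
    f = \sum_i (c i \*o K^~ (t i)).
Proof.
move=> [m [phi Kphi]] [H [ip [HK Hf]]].
have [n [t [A tA]]] := finite_rank_nodes R X m phi.
(* With [k y] the row of the [K y (t i)], [tA] reads [phi y = k y A], whence
   [K y z = k y (A A^T) (k z)^T]. *)
pose b y i := \sum_j K y (t j) * (A *m A^T) j i.
have K_nodes y : K^~ y = \sum_i (b y i \*o K^~ (t i)).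
  apply/funext => z; rewrite fct_sumE /= Kphi dotmx_sym.
  rewrite -[phi z]tA -[phi y in LHS]tA trmx_mul !mulmxA.
  rewrite -(mulmxA _ A) mxE; apply: eq_bigr => i _.
  rewrite [in LHS]mxE [X in _ * X]mxE [X in _ * X]mxE -Kphi /b.
  by congr (_ * _); apply: eq_bigr => j _; rewrite mxE -Kphi.
have [H0 HD HZ] := rkhs_subspace HK; have inner := rkhs_inner_product HK.
have HKt x : H (K^~ x) := rkhs_kernel HK x.
have ip_sum (c : 'I_n -> R) (r : seq 'I_n) :
    H (\sum_(i <- r) (c i \*o K^~ (t i))) /\
    ip (\sum_(i <- r) (c i \*o K^~ (t i))) f = \sum_(i <- r) c i * f (t i).
  elim: r => [|i r [Hr ipr]].
    rewrite !big_nil; split=> //; have := ipZl inner 0 H0 Hf.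
    by rewrite mul0r => <-; congr ip; apply/funext => x; rewrite /= mul0r.
  rewrite !big_cons; split; first exact: HD (HZ _ _ (HKt _)) Hr.
  rewrite (ipDl inner (HZ _ _ (HKt _)) Hr Hf) ipr (ipZl inner _ (HKt _) Hf).
  by rewrite (ip_sym inner (HKt _) Hf) -(rkhs_reproducing HK _ Hf).
(* Pairing [f] with the expansion of the section at [y] gives [f y = \sum_i b y i * f (t i)]; these
   coefficients come from collecting the factors of [K y (t j)]. *)
exists n, t, (fun j => \sum_i (A *m A^T) j i * f (t i)).
apply/funext => y; rewrite (rkhs_reproducing HK _ Hf) (ip_sym inner Hf (HKt _)).
have [_] := ip_sum (b y) (index_enum 'I_n); rewrite -K_nodes => ->.
rewrite fct_sumE /b; under eq_bigr do rewrite mulr_suml.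
rewrite exchange_big; apply: eq_bigr => j _; rewrite /= mulr_suml.
by apply: eq_bigr => i _; rewrite -mulrA mulrC.
Qed.

Lemma rkhs_exists_finite_rank (R : realType) (X : Type) (K : X -> X -> R) :
  finite_rank K -> exists H ip, is_rkhs K H ip.
Proof.
move=> [m [phi Kphi]].
have [n [t [A tA]]] := finite_rank_nodes R X m phi.
pose w (f : X -> R) : 'rV[R]_m := (\row_i f (t i)) *m A.
pose ip f g := (w f *m (w g)^T) 0 0.
pose H : set (X -> R) := [set f | forall y, f y = (w f *m (phi y)^T) 0 0].
have w0 : w 0 = 0.
  by rewrite /w (_ : \row_i _ = 0) ?mul0mx //; apply/rowP => i; rewrite !mxE.
have wD f g : w (f + g) = w f + w g.
  by rewrite /w -mulmxDl; congr (_ *m _); apply/rowP => i; rewrite !mxE.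
have wZ c f : w (c \*o f) = c *: w f.
  by rewrite /w scalemxAl; congr (_ *m _); apply/rowP => i; rewrite !mxE.
have wK x : w (K^~ x) = phi x.
  rewrite /w -[RHS]tA; congr (_ *m _); apply/rowP => i.
  by rewrite !mxE Kphi dotmx_sym mxE.
exists H, ip; split.
- split=> [y|f g Hf Hg y|c f Hf y].
  + by rewrite w0 mul0mx mxE.
  + by rewrite wD mulmxDl mxE -Hf -Hg.
  + by rewrite wZ -scalemxAl mxE -Hf.
- split=> [f g _ _|f g h _ _ _|c f g _ _|f _|f Hf /dotmx_eq0 wf0].
  + exact: dotmx_sym.
  + by rewrite /ip wD mulmxDl mxE.
  + by rewrite /ip wZ -scalemxAl mxE.
  + exact: dotmx_ge0.
  + by apply/funext => y; rewrite Hf wf0 mul0mx mxE.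
- move=> u Hu u_cauchy.
  have wB f g : w (f - g) = w f - w g.
    rewrite wD; congr (_ + _); rewrite -(scaleN1r (w g)) -wZ; congr w.
    by apply/funext => y; rewrite /= mulN1r.
  have le_norm f j : `|w f 0 j| <= ip_norm ip f.
    rewrite -sqrtr_sqr ler_wsqrtr // /ip dotmx_sqr (bigD1 j) //= lerDl.
    by apply: sumr_ge0 => i _; rewrite sqr_ge0.
  (* By [le_norm] each coordinate of a Cauchy sequence is Cauchy in [R]. *)
  have coord_cvg j : exists lj : R, w (u k) 0 j @[k --> \oo] --> lj.
    apply/cvg_ex/cauchy_cvgP/cauchy_ballP => e e0.
    have [N uN] := u_cauchy e e0.
    near_simpl; exists ([set k | N <= k]%N, [set k | N <= k]%N).
      by split; exists N.
    move=> [k1 k2] /= [k1N k2N]; rewrite -ball_normE /=.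
    have := le_norm (u k1 - u k2) j; rewrite wB !mxE => /le_lt_trans; apply.
    exact: uN.
  have [l ul] := choice coord_cvg.
  have cvg_comb q (v : nat -> 'I_q -> R) (v' b : 'I_q -> R) :
      (forall i, v k i @[k --> \oo] --> v' i) ->
      \sum_i v k i * b i @[k --> \oo] --> \sum_i v' i * b i.
    move=> vv'; apply: cvg_big => [|i _]; last exact: cvgMr_tmp.
    exact: add_continuous.
  pose f y := ((\row_j l j) *m (phi y)^T) 0 0.
  have uf y : u k y @[k --> \oo] --> f y.
    rewrite (_ : u^~ y = fun k => \sum_i w (u k) 0 i * (phi y)^T i 0).
      by rewrite /f mxE; apply: cvg_comb => i; rewrite mxE.
    by apply/funext => k; rewrite Hu mxE.
  (* [w] depends on finitely many values of its argument, linearly, so pointwise convergence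
     suffices; uniqueness of limits then identifies [w f] with [l]. *)
  have wuf j : w (u k) 0 j @[k --> \oo] --> w f 0 j.
    have wE g : w g 0 j = \sum_i g (t i) * A i j.
      by rewrite mxE; under eq_bigr do rewrite mxE.
    rewrite (funext (fun k => wE (u k))) wE.
    by apply: cvg_comb => i; apply: uf.
  have wf : w f = \row_j l j.
    apply/rowP => j; rewrite mxE.
    exact: (cvg_unique _ (wuf j) (ul j)).
  exists f; first by move=> y; rewrite wf.
  (* The squared norm is a finite sum of squares of coordinates, each tending to 0. *)
  rewrite -[X in _ --> X]sqrtr0.
  apply: (continuous_cvg _ (@sqrt_continuous R 0)).
  rewrite (funext (fun k => dotmx_sqr _ _ (w (u k - f)))).
  rewrite [X in _ --> X](_ : _ = \sum_(j < m) (0 : R) * 0); last first.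
    by rewrite big1 // => j _; rewrite mul0r.
  have wu0 j : w (u k - f) 0 j @[k --> \oo] --> 0.
    rewrite (_ : (fun k => _) = fun k => w (u k) 0 j - w f 0 j).
      by rewrite -(subrr (w f 0 j)); apply: cvgB => //; exact: cvg_cst.
    by apply/funext => k; rewrite wB [LHS]mxE; congr (_ + _); rewrite mxE.
  apply: cvg_big => [|i _]; first exact: add_continuous.
  exact: cvgM.
- by move=> x y; rewrite wK Kphi dotmx_sym.
- by move=> f x Hf; rewrite /ip wK Hf.
Qed.

(** * Decomposition by degree *)

Theorem theorem2 (R : realType) (d p : nat) (a : nat -> R)
    (hd : (1 <= d)%N) (hp : (1 <= p)%N)
    (ha : forall r : nat, (1 <= r <= p)%N -> 0 <= a r) :
  psd_kernel (@poly_kernel R d p a) /\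
  (forall f : 'cV[R]_d -> R, rkhs (@poly_kernel R d p a) f ->
     exists fs : nat -> 'cV[R]_d -> R,
       (forall r : nat, (1 <= r <= p)%N -> rkhs (@power_kernel R d r) (fs r)) /\
       f = \sum_(1 <= r < p.+1) fs r).
Proof.
have Kfin := finite_rank_poly_kernel R d p a.
split=> [|f Kf]; first exact: finite_rank_psd.
have [n [t [c ->]]] := rkhs_finite_rank_expansion _ _ _ _ Kfin Kf.
(* The weight [a r ^+ 2] goes into the coefficients, leaving sections of the unweighted kernel. *)
exists (fun r => \sum_i ((c i * a r ^+ 2) \*o (@power_kernel R d r)^~ (t i))).
split=> [r _|].
  have [H [ip HK]] :=
    rkhs_exists_finite_rank _ _ _ (finite_rank_power_kernel R d r).
  have [H0 HD HZ] := rkhs_subspace HK.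
  exists H, ip; split=> //; elim/big_ind: _ => // i _.
  exact/HZ/(rkhs_kernel HK).
rewrite exchange_big; apply: eq_bigr => i _; apply/funext => y.
rewrite fct_sumE /= /poly_kernel mulr_sumr.
by apply: eq_bigr => r _; rewrite mulrA.
Qed.
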